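(* Every abstract polytope can be constructed as a coset geometry. Precisely: let $\mathcal{P}$ be an abstract $n$-polytope ($n\ge 1$), let $\Gamma=\Gamma(\mathcal{P})$ be its automorphism group and let $X=\mathcal{T}(\mathcal{P})$ be its symmetry type graph. Then there is a voltage assignment $\xi:\Pi(X)\to\Gamma$ such that the coset poset $\mathcal{P}(X,\xi)$ (defined in the context, for any choice of the base vertices and of the paths $W_i^y$ used in its definition) is isomorphic to $\mathcal{P}$ as a partially ordered set.
   Context: **Polytopes.** A poset is flagged if it has a least and a greatest element and all its maximal chains (flags) have the same finite cardinality, say $n+2$; it then has an order-preserving rank function onto $\{-1,0,\dots,n\}$. Two flags are $i$-adjacent if they differ exactly in their element of rank $i$. An (abstract) $n$-polytope is a flagged poset with rank function onto $\{-1,\dots,n\}$ such that (diamond condition) for each flag $\Phi$ and each $i\in\{0,\dots,n-1\}$ there is a unique flag $\Phi^i$ that is $i$-adjacent to $\Phi$; and (strong flag connectedness) any two flags $\Phi,\Psi$ are joined by a sequence of flags, consecutive ones adjacent, all containing $\Phi\cap\Psi$. The flag graph $\mathcal{G}(\mathcal{P})$ has the flags as vertices, with an edge of colour $i$ joining each pair of $i$-adjacent flags. **Graphs.** Graphs may have parallel edges and semi-edges. Every edge consists of darts; a dart $d$ has an initial vertex, a terminal vertex and an inverse dart $d^{-1}$; an edge joining two different vertices (a link) consists of two mutually inverse darts, and a semi-edge consists of a single dart $d=d^{-1}$ with both ends at the same vertex. An $n$-premaniplex is a connected graph with edges coloured by $\{0,\dots,n-1\}$, all of whose edges are links or semi-edges,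 such that each vertex is incident to exactly one edge of each colour, and such that if $|i-j|>1$ every path of length $4$ alternating between colours $i$ and $j$ is closed. **Symmetry type graph.** For a polytope $\mathcal{P}$ and $G\le\Gamma(\mathcal{P})$, the symmetry type graph $\mathcal{T}(\mathcal{P},G)$ has the $G$-orbits of flags as vertices; for each flag $\Phi$ and colour $i$ there is an edge of colour $i$ joining the orbit of $\Phi$ to that of $\Phi^i$ (a semi-edge if these orbits coincide), so that each vertex has exactly one edge of each colour. $\mathcal{T}(\mathcal{P})=\mathcal{T}(\mathcal{P},\Gamma(\mathcal{P}))$. It is an $n$-premaniplex. **Voltages.** A voltage assignment $\xi:\Pi(X)\to\Gamma$ is a groupoid antimorphism from the fundamental groupoid of $X$; equivalently, it assigns to each dart $d$ an element $\xi(d)\in\Gamma$ with $\xi(d^{-1})=\xi(d)^{-1}$ and is extended to paths by $\xi(d_1d_2\cdots d_k)=\xi(d_k)\cdots\xi(d_2)\xi(d_1)$ (empty paths have trivial voltage). For a vertex $x$ and a set of colours $I$, $\xi(\Pi_I^x(X))$ is the subgroup of $\Gamma$ of voltages of closed paths based at $x$ using only darts with colours in $I$. Write $\overline{i}=\{0,\dots,n-1\}\setminus\{i\}$; $X_{\overline i}$ is the graph obtained from $X$ by deleting the edges of colour $i$, and $X_{\overline i}(y)$ is its connected component containing $y$. **The coset poset $\mathcal{P}(X,\xi)$.** Choose for every connected subgraph $C$ of $X$ a base vertex $f(C)\in C$. The elements of rank $i\in\{0,\dots,n-1\}$ of $\mathcal{P}(X,\xi)$ are the right cosets $\xi(\Pi^x_{\overline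 i}(X))\gamma$, $\gamma\in\Gamma$, where $x=f(C)$ and $C$ runs over the connected components of $X_{\overline i}$; they are regarded as formal copies, i.e. as triples consisting of $i$, $C$ and the coset, so that elements with different $i$ or different $C$ are different. For each vertex $y$ of $X$ and each $i$, fix a path $W^y_i$ inside $X_{\overline i}(y)$ from $f(X_{\overline i}(y))$ to $y$, and set $\alpha_i^y=\xi(W_i^y)$. For $i<j$, components $C$ of $X_{\overline i}$ and $C'$ of $X_{\overline j}$ with base vertices $x=f(C)$, $x'=f(C')$, and $\gamma,\gamma'\in\Gamma$, put $\xi(\Pi^x_{\overline i}(X))\gamma<\xi(\Pi^{x'}_{\overline j}(X))\gamma'$ if and only if $\alpha_i^y\,\xi(\Pi^x_{\overline i}(X))\gamma\cap\alpha_j^y\,\xi(\Pi^{x'}_{\overline j}(X))\gamma'\neq\emptyset$ for some vertex $y\in C\cap C'$. A least element (rank $-1$) and a greatest element (rank $n$) are adjoined. *)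

(* Defs.v *)
From HB Require Import structures.
From Stdlib Require Import Relations.
From mathcomp Require Import all_boot all_order all_algebra.
From mathcomp Require finmap.
From mathcomp Require Import boolp classical_sets functions cardinality.
From mathcomp Require Import zify.

Set Implicit Arguments.
Unset Strict Implicit.
Unset Printing Implicit Defensive.

Import Order.TTheory GRing.Theory Num.Theory.
Local Open Scope order_scope.
Local Open Scope classical_set_scope.
Local Open Scope card_scope.

Definition maximal_chain d (T : porderType d) (A : set T) : Prop :=
  total_on A (fun x y => x <= y) /\
  forall B : set T, total_on B (fun x y => x <= y) -> A `<=` B -> B = A.

Record flag d (T : porderType d) := Flag {
  flag_set :> set T;
  flag_max : maximal_chain flag_set }.

Record order_aut d (T : porderType d) := OrderAut {
  order_aut_fun :> T -> T;
  order_aut_bij : bijective order_aut_fun;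
  order_aut_mono : {mono order_aut_fun : x y / x <= y} }.

Section FlagTheory.
Context {d : Order.disp_t} {T : porderType d}.
Implicit Types (Phi Psi : flag T) (g h : order_aut T).

Lemma flag_eq Phi Psi : (forall x, flag_set Phi x <-> flag_set Psi x) -> Phi = Psi.
Proof.
case: Phi Psi => [A mA] [B mB] /= AB.
have E : A = B by apply/funext => x; apply/propext.
by subst B; congr Flag; apply: Prop_irrelevance.
Qed.

Lemma order_aut_eq g h : g =1 h -> g = h.
Proof.
case: g h => [f bf mf] [f' bf' mf'] /= /funext E; subst f'.
by congr OrderAut; apply: Prop_irrelevance.
Qed.

Definition order_aut_one := @OrderAut d T id (inv_bij (fun=> erefl)) (fun _ _ => erefl).

(* Automorphisms act on the right, as permutations do: the product [g * h]
   is [g] followed by [h]. *)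
Definition order_aut_mul g h : order_aut T.
Proof.
exists (h \o g); first exact: bij_comp (order_aut_bij h) (order_aut_bij g).
by move=> x y /=; rewrite !order_aut_mono.
Defined.

Lemma order_aut_inv_subproof g : exists h, cancel g h /\ cancel (order_aut_fun h) g.
Proof.
case: (order_aut_bij g) => f gK fK.
have bf : bijective f by exists g.
have mf : {mono f : x y / x <= y}.
  by move=> x y; rewrite -[in RHS](fK x) -[in RHS](fK y) order_aut_mono.
by exists (OrderAut bf mf).
Qed.

Definition order_aut_inv g : order_aut T := sval (cid (order_aut_inv_subproof g)).

Lemma order_aut_mulVg : left_inverse order_aut_one order_aut_inv order_aut_mul.
Proof.
move=> g; apply: order_aut_eq => x.
by have [gK hK] := svalP (cid (order_aut_inv_subproof g)); exact: hK.
Qed.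

Lemma order_aut_mulgV : right_inverse order_aut_one order_aut_inv order_aut_mul.
Proof.
move=> g; apply: order_aut_eq => x.
by have [gK hK] := svalP (cid (order_aut_inv_subproof g)); exact: gK.
Qed.

Lemma order_aut_mulA : associative order_aut_mul.
Proof. by move=> g h k; apply: order_aut_eq. Qed.

Lemma order_aut_mul1 : left_id order_aut_one order_aut_mul.
Proof. by move=> g; apply: order_aut_eq. Qed.

Lemma order_aut_mulr1 : right_id order_aut_one order_aut_mul.
Proof. by move=> g; apply: order_aut_eq. Qed.

HB.instance Definition _ := gen_eqMixin (order_aut T).
HB.instance Definition _ := gen_choiceMixin (order_aut T).
HB.instance Definition _ := isGroup.Build (order_aut T) order_aut_mulA
  order_aut_mul1 order_aut_mulr1 order_aut_mulVg order_aut_mulgV.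

Lemma order_aut_flag_max Phi g : maximal_chain (g @` Phi).
Proof.
have [f gK fK] := order_aut_bij g; have [tP mP] := flag_max Phi.
split=> [_ _ [x Px <-] [y Py <-]|B tB sB].
  by rewrite !order_aut_mono; exact: tP.
have E : g @^-1` B = Phi.
  apply: mP => [x y Bx By|x Px]; last by apply: sB; exists x.
  by have := tB _ _ Bx By; rewrite !order_aut_mono.
apply/seteqP; split=> // x Bx; exists (f x); last exact: fK.
by rewrite -E /= fK.
Qed.

Definition flag_act Phi g : flag T := Flag (order_aut_flag_max Phi g).

Definition flag_orbit Phi : set (flag T) := range (flag_act Phi).

Lemma flag_act1 Phi : flag_act Phi 1%g = Phi.
Proof.
apply: flag_eq => x; split=> [[y Py <-]//|Px]; by exists x.
Qed.

Lemma flag_actM Phi g h : flag_act Phi (g * h)%g = flag_act (flag_act Phi g) h.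
Proof.
apply: flag_eq => x; split=> [[y Py <-]|[_ [y Py <-] <-]]; last by exists y.
by exists (g y) => //; exists y.
Qed.

Lemma flag_orbit_act Phi g : flag_orbit (flag_act Phi g) = flag_orbit Phi.
Proof.
apply/seteqP; split=> _ [h _ <-]; first by rewrite -flag_actM; exists (g * h)%g.
by exists (g^-1 * h)%g => //; rewrite -flag_actM mulgA mulgV mul1g.
Qed.

End FlagTheory.

Definition adjacent d (T : porderType d) (rk : T -> int) (i : nat)
    (Phi Psi : flag T) : Prop :=
  Phi <> Psi /\ forall x, rk x <> Posz i -> (flag_set Phi x <-> flag_set Psi x).

(* The rank function is carried by the structure, but it is determined by the
   order: the conditions below force it to restrict to the increasing bijection
   of each flag onto {-1, ..., n}. *)
Record polytope (n : nat) := Polytope {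
  polytope_disp : Order.disp_t;
  face :> tbPOrderType polytope_disp;
  rank : face -> int;
  flagged : forall Phi : flag face, Phi #= `I_n.+2;
  rank_onto : range rank = [set k | (- 1 <= k <= n%:Z)%R];
  rank_lt : forall x y : face, x < y -> (rank x < rank y)%R;
  diamond : forall (Phi : flag face) (i : 'I_n), exists! Psi, adjacent rank i Phi Psi;
  strong_flag_connectivity : forall Phi Psi : flag face,
    clos_refl_trans (flag face)
      (fun A B => [/\ Phi `&` Psi `<=` A, Phi `&` Psi `<=` B &
                      exists i : 'I_n, adjacent rank i A B]) Phi Psi }.

Section PolytopeTheory.
Context {n : nat} {P : polytope n}.
Implicit Types (Phi Psi : flag P) (g : order_aut P) (i : 'I_n).

Lemma sub_II_eq (A : set nat) m : A `<=` `I_m -> A #= `I_m -> A = `I_m.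
Proof.
move=> sA cA; have fA : finite_set A by exact: sub_finite_set (finite_II m).
have fI := finite_II m.
rewrite -(fset_setK fA) -(fset_setK fI); suff -> : fset_set A = fset_set `I_m by [].
have sF : finmap.fsubset (fset_set A) (fset_set `I_m) by rewrite -fset_set_sub.
have := @finmap.eqEfcard _ (fset_set A) (fset_set `I_m).
by rewrite sF (card_fset_set cA) (card_fset_set (card_eqxx _)) leqnn => /eqP.
Qed.

Lemma flag_rank_onto (r : P -> nat) Phi k :
    (forall x, r x < n.+2)%N -> {homo r : x y / x < y >-> (x < y)%N} ->
  (k < n.+2)%N -> exists2 x, flag_set Phi x & r x = k.
Proof.
move=> rn rlt kn; have [tP _] := flag_max Phi.
suff E : r @` Phi = `I_n.+2 by have: `I_n.+2 k by []; rewrite -E => -[x]; exists x.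
apply: sub_II_eq => [_ [x _ <-]|]; first exact: rn.
apply: card_eq_trans (flagged Phi); apply: inj_card_eq => x y.
rewrite !inE => /tP/[apply] -[]; rewrite le_eqVlt => /orP[/eqP//|/rlt] + E.
  by rewrite E ltnn.
by rewrite E ltnn.
Qed.

Lemma flag_rank_uniq (r r' : P -> nat) Phi x :
    (forall x, r x < n.+2)%N -> {homo r : x y / x < y >-> (x < y)%N} ->
    (forall x, r' x < n.+2)%N -> {homo r' : x y / x < y >-> (x < y)%N} ->
  flag_set Phi x -> r x = r' x.
Proof.
suff le r1 r2 : (forall x, r1 x < n.+2)%N -> {homo r1 : x y / x < y >-> (x < y)%N} ->
    {homo r2 : x y / x < y >-> (x < y)%N} -> flag_set Phi x -> (r1 x <= r2 x)%N.
  by move=> *; apply/eqP; rewrite eqn_leq !le.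
move=> r1n r1lt r2lt; have [tP _] := flag_max Phi.
have [k] := ubnP (r1 x); elim: k x => // k IH x rk Px.
case E : (r1 x) => [//|j].
have jn : (j < n.+2)%N by have := r1n x; lia.
have [y Py Ey] := flag_rank_onto Phi r1n r1lt jn.
have yx : y < x.
  have [] := tP _ _ Py Px; rewrite le_eqVlt => /orP[/eqP xy|//].
  - by rewrite xy in Ey; lia.
  - by rewrite xy in E; lia.
  - by move=> /r1lt; lia.
by have := IH y _ Py; have := r2lt _ _ yx; lia.
Qed.

Lemma rank_bound (x : P) : (- 1 <= rank x <= n%:Z)%R.
Proof. by have: range (@rank n P) (rank x) by []; rewrite rank_onto. Qed.

Lemma rank_order_aut Phi g x : flag_set Phi x -> rank (g x) = rank x.
Proof.
move=> Px; pose r (y : P) := absz (rank y + 1)%R.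
have rn y : (r y < n.+2)%N by have := rank_bound y; rewrite /r; lia.
have rlt y z : y < z -> (r y < r z)%N.
  by move=> /rank_lt; have := rank_bound y; have := rank_bound z; rewrite /r; lia.
have glt y z : y < z -> (r (g y) < r (g z))%N.
  by move=> yz; apply: rlt; rewrite !lt_leAnge !order_aut_mono -lt_leAnge.
have := flag_rank_uniq (fun y => rn (g y)) glt rn rlt Px.
by have := rank_bound x; have := rank_bound (g x); rewrite /r; lia.
Qed.

(* The flag usually written Phi^i. *)
Definition flag_adj (i : 'I_n) Phi : flag P := sval (cid (diamond Phi i)).

Lemma flag_adjP i Phi : adjacent (@rank n P) i Phi (flag_adj i Phi).
Proof. by have [] := svalP (cid (diamond Phi i)). Qed.

Lemma flag_adj_uniq i Phi Psi : adjacent (@rank n P) i Phi Psi -> flag_adj i Phi = Psi.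
Proof. by have [_] := svalP (cid (diamond Phi i)); apply. Qed.

Lemma flag_adjK i : involutive (flag_adj i).
Proof.
move=> Phi; apply: flag_adj_uniq; have [ne eq] := flag_adjP i Phi.
by split=> [/esym//|x /eq []].
Qed.

Lemma flag_adj_act i Phi g :
  flag_adj i (flag_act Phi g) = flag_act (flag_adj i Phi) g.
Proof.
apply: flag_adj_uniq; have [ne eq] := flag_adjP i Phi.
split=> [/(congr1 (fun F => flag_act F (g^-1)%g))|x rx].
  by rewrite -!flag_actM mulgV !flag_act1.
split=> -[y Py gy]; exists y => //; apply/eq => //.
  by rewrite -(rank_order_aut g Py) gy.
by rewrite -(rank_order_aut g Py) gy.
Qed.

Lemma flag_has_rank Phi (k : int) :
  (- 1 <= k <= Posz n)%R -> exists2 x, flag_set Phi x & rank x = k.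
Proof.
move=> kn; pose r (y : P) := absz (rank y + 1)%R.
have rn y : (r y < n.+2)%N by have := rank_bound y; rewrite /r; lia.
have rlt y z : y < z -> (r y < r z)%N.
  by move=> /rank_lt; have := rank_bound y; have := rank_bound z; rewrite /r; lia.
have kk : (absz (k + 1)%R < n.+2)%N by lia.
have [x Px rx] := flag_rank_onto Phi rn rlt kk; exists x => //.
by have := rank_bound x; move: rx; rewrite /r; lia.
Qed.

Lemma flag_le Phi x y : flag_set Phi x -> flag_set Phi y -> (rank x < rank y)%R -> x <= y.
Proof.
have [tP _] := flag_max Phi; move=> Px Py xy; have [//|] := tP _ _ Px Py.
by rewrite le_eqVlt => /orP[/eqP E|/rank_lt]; [move: xy; rewrite E|]; lia.
Qed.

Lemma flag_adjC (i j : 'I_n) Phi : (i.+1 < j)%N \/ (j.+1 < i)%N ->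
  flag_adj j (flag_adj i Phi) = flag_adj i (flag_adj j Phi).
Proof.
move=> ij; have [neA eqA] := flag_adjP i Phi; have [neB eqB] := flag_adjP j Phi.
set A := flag_adj i Phi in neA eqA *; set B := flag_adj j Phi in neB eqB *.
have [tA _] := flag_max A; have [tB _] := flag_max B.
pose D : set P := [set x | (rank x = i /\ flag_set A x) \/ (rank x <> i /\ flag_set B x)].
have AB x y : rank x = i -> flag_set A x -> rank y <> i -> flag_set B y ->
    x <= y \/ y <= x.
  move=> rx Ax ry By; have [rj|rj] := EM (rank y = j); last first.
    by apply: tA => //; apply/eqA => //; apply/eqB.
  have in_n := ltn_ord i; have jn := ltn_ord j.
  pose k := (minn i j).+1.
  have [|z Pz rz] := @flag_has_rank Phi (Posz k); first by rewrite /k; lia.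
  have zi : rank z <> i by rewrite rz /k; lia.
  have zj : rank z <> j by rewrite rz /k; lia.
  have Az : flag_set A z by apply/eqA.
  have Bz : flag_set B z by apply/eqB.
  have rk0 : rank z = Posz k by [].
  case: ij => ij; [left|right]; apply: (le_trans (y := z)).
  - by apply: (flag_le Ax Az); rewrite rx rk0 /k; lia.
  - by apply: (flag_le Bz By); rewrite rj rk0 /k; lia.
  - by apply: (flag_le By Bz); rewrite rj rk0 /k; lia.
  - by apply: (flag_le Az Ax); rewrite rx rk0 /k; lia.
have mD : maximal_chain D.
  split=> [x y [[rx Ax]|[rx Bx]] [[ry Ay]|[ry By]]|E tE sE].
  - exact: tA.
  - exact: AB.
  - by have [] := AB y x ry Ay rx Bx; [right|left].
  - exact: tB.
  apply/seteqP; split=> // x Ex.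
  suff [y Dy ry] : exists2 y, D y & rank y = rank x.
    have [] := tE _ _ Ex (sE _ Dy); rewrite le_eqVlt => /orP[/eqP|/rank_lt].
    - by move=> ->.
    - by lia.
    - by move=> <-.
    - by lia.
  have [ri|ri] := EM (rank x = i).
    by have [y Ay ry] := flag_has_rank A (rank_bound x); exists y => //; left; rewrite ry.
  by have [y By ry] := flag_has_rank B (rank_bound x); exists y => //; right; rewrite ry.
have ji : Posz j <> Posz i by lia.
transitivity (Flag mD); last apply/esym; apply: flag_adj_uniq; split.
- move=> AD; apply: neB; apply: flag_eq => x.
  have [rj|rj] := EM (rank x = j); last exact: eqB.
  have ri : rank x <> i by rewrite rj.
  split=> [/(eqA _ ri)|Bx]; first by rewrite AD => -[[]|[]].
  by apply/(eqA _ ri); rewrite AD; right.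
- move=> x rj; have [ri|ri] := EM (rank x = i).
    by split=> [Ax|[[]|[]]] //; left.
  split=> [Ax|[[]|[_ Bx]]] //; last by apply/(eqA _ ri)/(eqB _ rj).
  by right; split=> //; apply/(eqB _ rj)/(eqA _ ri).
- move=> BD; apply: neA; apply: flag_eq => x.
  have [ri|ri] := EM (rank x = i); last exact: eqA.
  have rj : rank x <> j by rewrite ri => /esym.
  split=> [/(eqB _ rj)|Ax]; first by rewrite BD => -[[]|[]].
  by apply/(eqB _ rj); rewrite BD; left.
- by move=> x ri; split=> [Bx|[[]|[]]] //; right.
Qed.

Lemma flag_exists : exists Phi : flag P, True.
Proof.
have [F sF tF|A [tA mA]] :=
    @Zorn_bigcup P [set A | total_on A (fun x y : P => x <= y)].
  move=> x y [A FA Ax] [B FB By]; have [AB|BA] := tF _ _ FA FB.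
    by apply: (sF _ FB) => //; exact: AB.
  by apply: (sF _ FA) => //; exact: BA.
suff m : maximal_chain A by exists (Flag m).
split=> // B tB AB; apply: contrapT => nBA; apply: (mA B) => //.
by rewrite properEneq; split=> //; apply/eqP => BA; apply: nBA.
Qed.

End PolytopeTheory.

(* An edge is a pair {d, d^-1} of mutually inverse darts; it is a semi-edge when
   d = d^-1. *)
Record cgraph (n : nat) := CGraph {
  vertex : Type;
  dart : Type;
  dart_init : dart -> vertex;
  dart_term : dart -> vertex;
  dart_inv : dart -> dart;
  colour : dart -> 'I_n;
  dart_invK : involutive dart_inv;
  dart_init_inv : forall d, dart_init (dart_inv d) = dart_term d;
  colour_inv : forall d, colour (dart_inv d) = colour d }.

Record subgraph n (X : cgraph n) := Subgraph {
  sub_vertex : set (vertex X);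
  sub_dart : set (dart X);
  sub_dart_inv : forall d, sub_dart d -> sub_dart (dart_inv d);
  sub_dart_init : forall d, sub_dart d -> sub_vertex (dart_init d) }.

Section Graphs.
Context {n : nat} {X : cgraph n}.
Implicit Types (x y z : vertex X) (d : dart X) (p q : seq (dart X)) (Y : subgraph X).

Fixpoint walk Y x p y : Prop :=
  match p with
  | [::] => sub_vertex Y x /\ x = y
  | d :: q => [/\ sub_dart Y d, dart_init d = x & walk Y (dart_term d) q y]
  end.

Definition connected Y : Prop :=
  (exists x, sub_vertex Y x) /\
  forall x y, sub_vertex Y x -> sub_vertex Y y -> exists p, walk Y x p y.

(* All the vertices are kept, with the edges whose colour is in I. *)
Definition colour_subgraph (I : {pred 'I_n}) : subgraph X.
Proof.
exists setT [set d | colour d \in I] => [d|//].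
by rewrite /= colour_inv.
Defined.

Definition reachable Y x : set (vertex X) :=
  [set y | sub_vertex Y x /\ exists p, walk Y x p y].

Lemma walk_rcons Y x p y d :
  walk Y x p y -> sub_dart Y d -> dart_init d = y -> walk Y x (rcons p d) (dart_term d).
Proof.
elim: p x => [|e p IH] x /= => [[Yx ->] Yd dy|[Ye ex w] Yd dy].
  split=> //; split=> //; rewrite -dart_init_inv.
  by apply/sub_dart_init/sub_dart_inv.
by split=> //; exact: IH.
Qed.

Definition component Y x : subgraph X.
Proof.
exists (reachable Y x) [set d | sub_dart Y d /\ reachable Y x (dart_init d)].
  move=> d [Yd [Yx [p w]]]; split; first exact: sub_dart_inv.
  split=> //; exists (rcons p d); rewrite dart_init_inv; exact: walk_rcons w Yd _.
by move=> d [].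
Defined.

Definition is_component Y (C : subgraph X) : Prop :=
  exists2 x, sub_vertex Y x & C = component Y x.

End Graphs.

Arguments colour_subgraph {n} X I.

Record premaniplex n (X : cgraph n) : Prop := Premaniplex {
  premaniplex_connected : connected (colour_subgraph X predT);
  premaniplex_edges : forall d : dart X, dart_init d = dart_term d -> dart_inv d = d;
  premaniplex_colours : forall (x : vertex X) (i : 'I_n),
    exists! d : dart X, dart_init d = x /\ colour d = i;
  premaniplex_alternating : forall (x y : vertex X) (p : seq (dart X)) (i j : 'I_n),
    (i.+1 < j \/ j.+1 < i)%N -> walk (colour_subgraph X predT) x p y ->
    [seq colour d | d <- p] = [:: i; j; i; j] -> x = y }.

Record stg_vertex n (P : polytope n) := StgVertex {
  stg_orbit :> set (flag P);
  stg_orbitP : exists Phi, stg_orbit = flag_orbit Phi }.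

Section SymmetryTypeGraph.
Context {n : nat} (P : polytope n).
Implicit Types (O : stg_vertex P) (Phi : flag P) (i : 'I_n).

Lemma stg_vertex_eq O O' : stg_orbit O = stg_orbit O' -> O = O'.
Proof.
by case: O O' => [A a] [B b] /= E; subst B; congr StgVertex; apply: Prop_irrelevance.
Qed.

Definition stg_vertex_of Phi : stg_vertex P :=
  StgVertex (ex_intro _ Phi (erefl (flag_orbit Phi))).

Lemma flag_adj_orbit i Phi : flag_adj i @` flag_orbit Phi = flag_orbit (flag_adj i Phi).
Proof.
apply/seteqP; split=> [_ [_ [g _ <-] <-]|_ [g _ <-]].
  by exists g; rewrite ?flag_adj_act.
by exists (flag_act Phi g); [exists g|rewrite flag_adj_act].
Qed.

Lemma stg_adj_subproof i O : exists Psi, flag_adj i @` O = flag_orbit Psi.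
Proof. by have [Phi ->] := stg_orbitP O; exists (flag_adj i Phi); exact: flag_adj_orbit. Qed.

(* The orbit consisting of the flags Phi^i with Phi in O. *)
Definition stg_adj i O : stg_vertex P := StgVertex (stg_adj_subproof i O).

Lemma stg_adjK i : involutive (stg_adj i).
Proof.
move=> O; apply: stg_vertex_eq; rewrite /= image_comp.
apply/seteqP; split=> [_ [Phi OPhi <-]|Phi OPhi]; first by rewrite /= flag_adjK.
by exists Phi; rewrite //= flag_adjK.
Qed.

Lemma stg_adj_of i Phi : stg_adj i (stg_vertex_of Phi) = stg_vertex_of (flag_adj i Phi).
Proof. by apply: stg_vertex_eq; exact: flag_adj_orbit. Qed.

(* The dart [(O, i)] leaves [O] along its edge of colour [i]. *)
Definition stg : cgraph n.
Proof.
refine (@CGraph n (stg_vertex P) (stg_vertex P * 'I_n) fst (fun d => stg_adj d.2 d.1)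
  (fun d => (stg_adj d.2 d.1, d.2)) snd _ _ _) => // -[O i].
by rewrite /= stg_adjK.
Defined.

Lemma stg_premaniplex : premaniplex stg.
Proof.
split=> [|[O i] /= <-//|O i|O O' p i j ij].
- split; first by have [Phi _] := @flag_exists n P; exists (stg_vertex_of Phi).
  move=> O O' _ _; have [Phi EO] := stg_orbitP O; have [Psi EO'] := stg_orbitP O'.
  have -> : O = stg_vertex_of Phi by exact: stg_vertex_eq.
  have -> : O' = stg_vertex_of Psi by exact: stg_vertex_eq.
  elim: (strong_flag_connectivity Phi Psi) => {O O' EO EO'}.
  + move=> A B [_ _ [i /flag_adj_uniq <-]].
    by exists [:: (stg_vertex_of A, i)]; split=> //; split=> //; exact: stg_adj_of.
  + by move=> A; exists [::].
  + move=> A B C _ [p wp] _ [q wq]; exists (p ++ q); move: wp.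
    elim: p (stg_vertex_of A) => [|d p IH] x /= => [[_ ->]//|[Yd dx w]].
    by split=> //; exact: IH.
- exists (O, i); split=> // -[O' i'] [/= -> ->] //.
- case: p => [|[O1 i1] [|[O2 i2] [|[O3 i3] [|[O4 i4] [|]]]]] //= w [E1 E2 E3 E4].
  subst i1 i2 i3 i4; case: w => _ <- [_ -> [_ -> [_ -> [_ <-]]]].
  have [Phi EO] := stg_orbitP O1.
  have -> : O1 = stg_vertex_of Phi by exact: stg_vertex_eq.
  by rewrite !stg_adj_of (flag_adjC _ ij) flag_adjK flag_adjK.
Qed.

End SymmetryTypeGraph.

(* The extension to paths, [path_voltage] below, reverses products: it is the
   antimorphism of the fundamental groupoid determined by its values on darts. *)
Record voltage n (X : cgraph n) (Gamma : groupType) := Voltage {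
  dart_voltage :> dart X -> Gamma;
  dart_voltage_inv : forall d, dart_voltage (dart_inv d) = ((dart_voltage d)^-1)%g }.

Record base_choice n (X : cgraph n) := BaseChoice {
  base :> subgraph X -> vertex X;
  baseP : forall C, connected C -> sub_vertex C (base C) }.

Section CosetPoset.
Context {n : nat} {X : cgraph n} {Gamma : groupType}.
Local Open Scope group_scope.

Definition delete_colour (i : 'I_n) : subgraph X := colour_subgraph X (predC1 i).

Fixpoint path_voltage (xi : voltage X Gamma) (p : seq (dart X)) : Gamma :=
  if p is d :: q then path_voltage xi q * xi d else 1.

(* xi(Pi_I^x(X)) *)
Definition voltage_group (xi : voltage X Gamma) (I : {pred 'I_n}) (x : vertex X) :
    set Gamma :=
  [set path_voltage xi p | p in [set p | walk (colour_subgraph X I) x p x]].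

(* The paths W_i^y. *)
Record path_choice (f : base_choice X) := PathChoice {
  chosen_path :> vertex X -> 'I_n -> seq (dart X);
  chosen_pathP : forall y i, let C := component (delete_colour i) y in
    walk C (f C) (chosen_path y i) y }.

Definition right_coset (H : set Gamma) (g : Gamma) : set Gamma := [set h * g | h in H].

Definition left_translate (a : Gamma) (K : set Gamma) : set Gamma := [set a * k | k in K].

(* The elements of rank 0, ..., n-1, as formal triples: cosets coming from
   different ranks or components are distinct even if they are equal as sets. *)
Record coset_face (xi : voltage X Gamma) (f : base_choice X) := CosetFace {
  coset_rank : 'I_n;
  coset_comp : subgraph X;
  coset_set : set Gamma;
  coset_compP : is_component (delete_colour coset_rank) coset_comp;
  coset_setP : exists g,
    coset_set = right_coset (voltage_group xi (predC1 coset_rank) (f coset_comp)) g }.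

Inductive coset_elt (xi : voltage X Gamma) (f : base_choice X) :=
  | CosetLeast
  | CosetProper of coset_face xi f
  | CosetGreatest.

Definition coset_face_lt xi f (W : path_choice f) (F F' : coset_face xi f) : Prop :=
  let alpha y i := path_voltage xi (W y i) in
  (coset_rank F < coset_rank F')%N /\
  exists y, [/\ sub_vertex (coset_comp F) y, sub_vertex (coset_comp F') y &
    left_translate (alpha y (coset_rank F)) (coset_set F) `&`
    left_translate (alpha y (coset_rank F')) (coset_set F') !=set0].

Definition coset_lt xi f (W : path_choice f) (a b : coset_elt xi f) : Prop :=
  match a, b with
  | CosetLeast, CosetLeast => False
  | CosetLeast, _ => True
  | CosetProper F, CosetProper F' => coset_face_lt W F F'
  | CosetProper _, CosetGreatest => True
  | _, _ => False
  end.

Definition coset_le xi f (W : path_choice f) (a b : coset_elt xi f) : Prop :=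
  a = b \/ coset_lt W a b.

End CosetPoset.

(* Main.v *)
Require Import Defs.
From mathcomp Require Import all_boot all_order all_algebra.
From mathcomp Require Import boolp classical_sets functions cardinality.
From mathcomp Require Import zify.

(** Fix a base flag [B_O] in every flag orbit [O], and let the voltage of the
    dart of colour [i] leaving [O] be the unique automorphism [g] such that
    [B_O^i = B_O' g], where [O'] is the orbit of [B_O^i].  A path from [O] to
    [O'] of voltage [g] then lifts to a sequence of adjacent flags from [B_O]
    to [B_O' g].  Strong flag connectedness says that two flags share their
    face of rank [i] iff they are joined by such a lift avoiding the colour
    [i]; hence the voltage group of the closed paths at [O] avoiding [i] is the
    stabilizer of the face of rank [i] of [B_O].  The coset of [g] over the
    component with base vertex [O] therefore consists of the automorphisms that
    send this face to a given face, and incidence of cosets at a vertex [y]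
    says that some image of [B_y] contains both faces. *)

Set Implicit Arguments.
Unset Strict Implicit.
Unset Printing Implicit Defensive.

Import Order.TTheory.
Local Open Scope order_scope.
Local Open Scope classical_set_scope.

(** * Extension of chains to flags *)

Lemma chain_sub_flag d (T : porderType d) (A : set T) :
  total_on A (fun x y => x <= y) -> exists Phi : flag T, A `<=` Phi.
Proof.
move=> tA.
(* Zorn is applied to the sets [B] with [A] ∪ [B] a chain, not to the chains containing [A]: the
   family must be closed under unions of all its chains, the empty one included. *)
have [F sF tF|B [tB mB]] :=
    @Zorn_bigcup T [set B | total_on (A `|` B) (fun x y : T => x <= y)].
  move=> x y [Ax|[C FC Cx]] [Ay|[D FD Dy]].
  - exact: tA.
  - by apply: (sF _ FD); [left|right].
  - by apply: (sF _ FC); [right|left].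
  - have [CD|DC] := tF _ _ FC FD.
      by apply: (sF _ FD); right => //; exact: CD.
    by apply: (sF _ FC); right => //; exact: DC.
suff m : maximal_chain (A `|` B) by exists (Flag m) => x Ax; left.
split=> // E tE sE; apply: contrapT => nE; apply: (mB E).
  rewrite properEneq; split; last by move=> x Bx; apply: sE; right.
  apply/eqP => BE; apply: nE; apply/seteqP; split=> // x Ex; by right; rewrite BE.
by rewrite /= setUidr // => x Ax; apply: sE; left.
Qed.

(** * Walks and connected components in coloured graphs *)

Section Graph.
Context {n : nat} {X : cgraph n}.
Implicit Types (Y C : subgraph X) (x y z : vertex X).

Lemma subgraph_eq Y C :
  sub_vertex Y = sub_vertex C -> sub_dart Y = sub_dart C -> Y = C.
Proof.
case: Y C => [V D a b] [V' D' a' b'] /= EV ED; subst V' D'.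
by congr Subgraph; apply: Prop_irrelevance.
Qed.

Lemma walk_cat Y x y z p q : walk Y x p y -> walk Y y q z -> walk Y x (p ++ q) z.
Proof.
elim: p x => [|d p IH] x /= => [[_ ->]//|[Yd dx w] wq].
by split=> //; exact: IH.
Qed.

Lemma walk_init Y x y p : walk Y x p y -> sub_vertex Y x.
Proof. by case: p => [[]|d p [/sub_dart_init Yd <-]]. Qed.

Lemma walk_rev Y x y p : walk Y x p y -> exists q, walk Y y q x.
Proof.
elim: p x => [|d p IH] x /= => [[Yx <-]|[Yd dx /IH[q w]]]; first by exists [::].
exists (rcons q (dart_inv d)); rewrite -dx -{2}(dart_invK d) dart_init_inv.
by apply: walk_rcons w _ _; [exact: sub_dart_inv|exact: dart_init_inv].
Qed.

Lemma walk_term Y x y p : walk Y x p y -> sub_vertex Y y.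
Proof. by move=> /walk_rev[q /walk_init]. Qed.

Lemma component_walk Y x y p : walk Y x p y -> component Y y = component Y x.
Proof.
move=> w; have [q wq] := walk_rev w.
have E : reachable Y y = reachable Y x.
  apply/seteqP; split=> z [_ [r wr]]; split.
  - exact: walk_init w.
  - by exists (p ++ r); apply: walk_cat wr.
  - exact: walk_init wq.
  - by exists (q ++ r); apply: walk_cat wr.
by apply: subgraph_eq => /=; rewrite E.
Qed.

Lemma sub_component_walk Y C y z p : is_component Y C -> walk C y p z -> walk Y y p z.
Proof.
move=> [x _ ->]; elim: p y => [|d p IH] y /= => [[[Yx [q /walk_term Yy]] <-]//|[[Yd _] dy w]].
by split=> //; exact: IH.
Qed.

Lemma walk_component Y x y z p :
  reachable Y x y -> walk Y y p z -> walk (component Y x) y p z.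
Proof.
elim: p y => [|d p IH] y xy /= => [[Yy <-]//|[Yd dy w]].
split=> //; first by rewrite dy.
apply: IH w; case: xy => Yx [q wq]; split=> //.
by exists (rcons q d); exact: walk_rcons wq _ _.
Qed.

Lemma component_connected Y C : is_component Y C -> connected C.
Proof.
move=> [x Yx ->]; split; first by exists x; split=> //; exists [::].
move=> y z [_ [p wp]] [_ [q wq]]; have [r wr] := walk_rev wp.
exists (r ++ q); apply: walk_component; last exact: walk_cat wq.
by split=> //; exists p.
Qed.

Lemma component_eq Y C x : is_component Y C -> sub_vertex C x -> component Y x = C.
Proof. by move=> [y Yy ->] [_ [p /component_walk]]. Qed.

Lemma component_base (f : base_choice X) Y C : is_component Y C -> sub_vertex C (f C).
Proof. by move=> /component_connected; exact: baseP. Qed.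

Lemma path_voltage_cat (Gamma : groupType) (xi : voltage X Gamma) p q :
  path_voltage xi (p ++ q) = (path_voltage xi q * path_voltage xi p)%g.
Proof. by elim: p => [|d p IH] /=; rewrite ?mulg1// IH mulgA. Qed.

End Graph.

(** * Faces of flags and the free action of automorphisms *)

Section Polytope.
Context {n : nat} {P : polytope n}.
Implicit Types (Phi Psi : flag P) (g h : order_aut P) (i j : 'I_n) (x y : P).

Lemma face_flag x : exists Phi : flag P, flag_set Phi x.
Proof.
have [_ _ -> ->|Phi sPhi] := @chain_sub_flag _ P [set x]; first by left.
by exists Phi; exact: sPhi.
Qed.

Lemma le_face_flag x y : x <= y -> exists2 Phi : flag P, flag_set Phi x & flag_set Phi y.
Proof.
move=> xy; have [|Phi sPhi] := @chain_sub_flag _ P [set x; y].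
  by move=> _ _ [->|->] [->|->]; rewrite ?xy ?lexx; auto.
by exists Phi; apply: sPhi; [left|right].
Qed.

Lemma flag_rank_inj Phi x y :
  flag_set Phi x -> flag_set Phi y -> rank x = rank y -> x = y.
Proof.
have [tP _] := flag_max Phi.
move=> Px Py E; have [] := tP _ _ Px Py; rewrite le_eqVlt => /orP[/eqP//|/rank_lt].
  by rewrite E ltxx.
by rewrite E ltxx.
Qed.

Lemma rank_aut g x : rank (g x) = rank x.
Proof. by have [Phi Px] := face_flag x; exact: rank_order_aut Px. Qed.

Lemma rank_bot x : rank x = (- 1)%R -> x = \bot.
Proof.
move=> rx; have := le0x x; rewrite le_eqVlt => /orP[/eqP//|/rank_lt].
by have := rank_bound (\bot : P); lia.
Qed.

Lemma rank_top x : rank x = n%:Z%R -> x = \top.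
Proof.
move=> rx; have := lex1 x; rewrite le_eqVlt => /orP[/eqP//|/rank_lt].
by have := rank_bound (\top : P); lia.
Qed.

Lemma rank_botE : rank (\bot : P) = (- 1)%R.
Proof.
have: range (@rank n P) (- 1)%R by rewrite rank_onto /=; lia.
by move=> [x _ rx]; rewrite -rx (rank_bot rx).
Qed.

Lemma rank_topE : rank (\top : P) = n%:Z%R.
Proof.
have: range (@rank n P) n%:Z%R by rewrite rank_onto /=; lia.
by move=> [x _ rx]; rewrite -rx (rank_top rx).
Qed.

(** The action commutes with adjacency, so by connectedness fixing one flag means fixing all of
    them. As ranks are preserved and a flag has one face of each rank, every face is then fixed. *)
Lemma flag_act_eq1 Phi g : flag_act Phi g = Phi -> g = 1%g.
Proof.
move=> fixPhi; suff fix_all Psi : flag_act Psi g = Psi.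
  apply: order_aut_eq => x; have [Psi Px] := face_flag x.
  apply: (flag_rank_inj _ Px) (rank_aut _ _).
  by rewrite -(fix_all Psi); exists x.
elim: (strong_flag_connectivity Phi Psi) fixPhi => //.
  move=> A B [_ _ [i /flag_adj_uniq <-]] fixA.
  by rewrite -flag_adj_act fixA.
by move=> A B C _ IHA _ IHB /IHA.
Qed.

Lemma flag_act_inj Phi g h : flag_act Phi g = flag_act Phi h -> g = h.
Proof.
move=> E; apply: (mulIg h^-1%g); rewrite mulgV; apply: (@flag_act_eq1 Phi).
by rewrite flag_actM E -flag_actM mulgV flag_act1.
Qed.

Lemma flag_orbit_eq Phi Psi :
  flag_orbit Phi = flag_orbit Psi -> exists g, Phi = flag_act Psi g.
Proof.
move=> E; have: flag_orbit Phi Phi by exists 1%g => //; rewrite flag_act1.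
by rewrite E => -[g _ <-]; exists g.
Qed.

Lemma face_at_subproof i Phi : exists x, flag_set Phi x /\ rank x = i.
Proof.
have := ltn_ord i => ?; have [|x] := @flag_has_rank n P Phi (Posz i); first by lia.
by exists x.
Qed.

Definition face_at i Phi : P := sval (cid (face_at_subproof i Phi)).

Lemma face_at_flag i Phi : flag_set Phi (face_at i Phi).
Proof. by case: (svalP (cid (face_at_subproof i Phi))). Qed.

Lemma rank_face_at i Phi : rank (face_at i Phi) = i.
Proof. by case: (svalP (cid (face_at_subproof i Phi))). Qed.

Lemma face_at_eq i Phi x : flag_set Phi x -> rank x = i -> face_at i Phi = x.
Proof.
by move=> Px rx; apply: (flag_rank_inj (face_at_flag i Phi) Px); rewrite rank_face_at.
Qed.

Lemma face_at_act i Phi g : face_at i (flag_act Phi g) = g (face_at i Phi).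
Proof.
apply: face_at_eq; last by rewrite rank_aut rank_face_at.
by exists (face_at i Phi) => //; exact: face_at_flag.
Qed.

Lemma face_at_adj i j Phi : j != i -> face_at i (flag_adj j Phi) = face_at i Phi.
Proof.
move=> /eqP ji; have [_ eqP] := flag_adjP j Phi.
apply: face_at_eq (rank_face_at _ _); apply/eqP; last exact: face_at_flag.
by rewrite rank_face_at => -[/ord_inj/esym].
Qed.

(** Flags that differ at most in rank [i] and share a face of that rank are equal, whereas adjacent
    flags are distinct. *)
Lemma adjacent_face i j Phi Psi x : rank x = i -> flag_set Phi x -> flag_set Psi x ->
  adjacent (@rank n P) j Phi Psi -> j != i.
Proof.
move=> rx Px Qx [ne eq]; apply/eqP => ji; subst j; apply: ne.
apply: flag_eq => y; have [ry|/eq//] := EM (rank y = i).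
by split=> [Py|Qy]; [rewrite (flag_rank_inj Py Px)|rewrite (flag_rank_inj Qy Qx)];
  rewrite ?rx ?ry.
Qed.

End Polytope.

(** * The voltage assignment and its groups *)

Section OrbitVoltage.
Context {n : nat} (P : polytope n).
Implicit Types (O : stg_vertex P) (g h : order_aut P) (i : 'I_n).

Definition base_flag O : flag P := sval (cid (stg_orbitP O)).

Lemma flag_orbit_base O : flag_orbit (base_flag O) = O.
Proof. by rewrite -(svalP (cid (stg_orbitP O))). Qed.

Lemma flag_of_base (Psi : flag P) : exists O g, Psi = flag_act (base_flag O) g.
Proof.
exists (stg_vertex_of Psi).
by apply: flag_orbit_eq; rewrite flag_orbit_base.
Qed.

(** With [flag_of_base], this gives each flag unique coordinates ([O], [g]): orbits are disjoint and
    the action on flags is free. *)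
Lemma base_flag_inj O O' g g' :
  flag_act (base_flag O) g = flag_act (base_flag O') g' -> O = O' /\ g = g'.
Proof.
move=> E; have OO' : O = O'.
  by apply: stg_vertex_eq; rewrite -!flag_orbit_base -(flag_orbit_act _ g) E flag_orbit_act.
by split=> //; subst O'; exact: flag_act_inj E.
Qed.

Lemma dart_aut_subproof O i :
  exists g, flag_adj i (base_flag O) = flag_act (base_flag (stg_adj i O)) g.
Proof.
apply: flag_orbit_eq; rewrite flag_orbit_base /= -flag_adj_orbit.
by rewrite flag_orbit_base.
Qed.

Definition dart_aut (d : dart (stg P)) : order_aut P :=
  sval (cid (dart_aut_subproof d.1 d.2)).

Lemma dart_autP O i :
  flag_adj i (base_flag O) = flag_act (base_flag (stg_adj i O)) (dart_aut (O, i)).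
Proof. exact: (svalP (cid (dart_aut_subproof O i))). Qed.

Lemma dart_aut_inv d : dart_aut (dart_inv d) = ((dart_aut d)^-1)%g.
Proof.
case: d => O i; apply: (@flag_act_inj _ _ (base_flag O)).
have := dart_autP (stg_adj i O) i; rewrite stg_adjK => <-.
(* Undoing the voltage exhibits the base flag of the target orbit as the [i]-adjacent flag of a
   translate of [base_flag O]. *)
have /(congr1 (fun A => flag_act A (dart_aut (O, i))^-1%g)) := dart_autP O i.
rewrite -flag_actM mulgV flag_act1 => <-.
by rewrite flag_adj_act flag_adjK.
Qed.

Definition orbit_voltage : voltage (stg P) (order_aut P) := Voltage dart_aut_inv.

Local Notation xi := orbit_voltage.

(** Each step has a colour other than [i] and so keeps the face of rank [i]. In [path_voltage] the
    later darts stand on the left, and in [g * h] the factor [g] acts first, so the two orders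
    agree. *)
Lemma walk_face i O p O' : walk (@delete_colour n (stg P) i) O p O' ->
  face_at i (base_flag O) = path_voltage xi p (face_at i (base_flag O')).
Proof.
elim: p O => [|[Q j] p IH] O /= => [[_ ->]//|[ji <- /IH E]].
rewrite -(face_at_adj (base_flag Q) ji) dart_autP face_at_act /=.
by rewrite E.
Qed.

Lemma base_flag_step (i j : 'I_n) O O' g g' (x : P) :
    rank x = i -> flag_set (flag_act (base_flag O) g) x ->
    flag_set (flag_act (base_flag O') g') x ->
    adjacent (@rank n P) j (flag_act (base_flag O) g) (flag_act (base_flag O') g') ->
  walk (@delete_colour n (stg P) i) O [:: (O, j)] O' /\ g' = (dart_aut (O, j) * g)%g.
Proof.
move=> rx Ax Bx AB; have ji := adjacent_face rx Ax Bx AB.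
have := flag_adj_uniq AB.
by rewrite flag_adj_act dart_autP -flag_actM => /base_flag_inj[<- <-].
Qed.

(** Converse of [walk_face]: strong connectedness joins the two flags through flags that contain
    their common face, and [base_flag_step] reads each adjacency as a dart of colour other than
    [i]. *)
Lemma face_walk i O O' g g' :
    g (face_at i (base_flag O)) = g' (face_at i (base_flag O')) ->
  exists2 p, walk (@delete_colour n (stg P) i) O p O' & g' = (path_voltage xi p * g)%g.
Proof.
rewrite -!face_at_act.
move EA : (flag_act _ g) => A; move EB : (flag_act _ g') => B E.
have Ax := face_at_flag i A; have Bx := face_at_flag i B; rewrite -E in Bx.
have rx := rank_face_at i A.
move: (face_at i A) Ax Bx rx => x Ax Bx rx {E}.
have: (A `&` B) x by [].
have := strong_flag_connectivity A B.
(* The induction changes the end flags, while the set contained in all intermediate flags has to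
   stay fixed; only its element [x] matters. *)
move: (A `&` B) => S conn Sx {Ax Bx}.
elim: conn O O' g g' EA EB => {A B} [A B [SA SB [j AB]]|A|A B C _ IHA _ IHB] O O' g g' EA EC.
- have [//|||w ->] := @base_flag_step i j O O' g g' x rx.
  + by rewrite EA; exact: SA.
  + by rewrite EC; exact: SB.
  + by rewrite EA EC.
  + by exists [:: (O, j)]; rewrite //= mul1g.
- have [<- <-] := base_flag_inj (etrans EA (esym EC)).
  by exists [::]; rewrite //= mul1g.
- have [Q [h /esym EB]] := flag_of_base B.
  have [p wp hE] := IHA _ _ _ _ EA EB; have [q wq ->] := IHB _ _ _ _ EB EC.
  exists (p ++ q); first exact: walk_cat wp wq.
  by rewrite path_voltage_cat hE mulgA.
Qed.

Lemma voltage_group_stabilizer i O : voltage_group xi (predC1 i) O =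
  [set h | h (face_at i (base_flag O)) = face_at i (base_flag O)].
Proof.
apply/seteqP; split=> [_ [p /walk_face w <-]//|h hO].
have [|p w ->] := @face_walk i O O 1%g h; first by rewrite hO.
by exists p; rewrite ?mulg1.
Qed.

Lemma right_coset_stabilizer i O g : right_coset (voltage_group xi (predC1 i) O) g =
  [set h | h (face_at i (base_flag O)) = g (face_at i (base_flag O))].
Proof.
rewrite voltage_group_stabilizer.
apply/seteqP; split=> [_ [h hO <-]|h hO]; first by rewrite /= hO.
exists (h * g^-1)%g; last by rewrite -mulgA mulVg mulg1.
by rewrite /= hO -[RHS]/((1%g : order_aut P) _) -(mulgV g).
Qed.

(** * The correspondence between cosets and proper faces *)

Section Faces.
Context (f : base_choice (stg P)) (W : path_choice f).
Implicit Types F : coset_face xi f.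

Definition root_face F : P :=
  face_at (coset_rank F) (base_flag (f (coset_comp F))).

(** The representative of the coset is a choice, but by [coset_setE] all elements of the coset send
    the root face to this same face. *)
Definition face_of F : P := sval (cid (coset_setP F)) (root_face F).

Lemma coset_setE F : coset_set F = [set h | h (root_face F) = face_of F].
Proof. by rewrite {1}(svalP (cid (coset_setP F))) right_coset_stabilizer. Qed.

Lemma rank_face_of F : rank (face_of F) = coset_rank F.
Proof. by rewrite rank_aut rank_face_at. Qed.

Lemma comp_base F : sub_vertex (coset_comp F) (f (coset_comp F)).
Proof. exact: component_base (coset_compP F). Qed.

(** Components without colour [i] correspond to orbits of faces of rank [i]: [walk_face] turns paths
    into automorphisms matching faces, [face_walk] does the reverse. *)
Lemma comp_vertexP F O : sub_vertex (coset_comp F) O <->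
  exists g, g (face_at (coset_rank F) (base_flag O)) = face_of F.
Proof.
split=> [FO|[g]].
  have [_ conn] := component_connected (coset_compP F).
  have [p /(sub_component_walk (coset_compP F))/walk_face w] := conn _ _ (comp_base F) FO.
  rewrite /face_of /root_face w.
  by exists (path_voltage xi p * sval (cid (coset_setP F)))%g.
move=> /esym/face_walk[p w _]; have E := component_walk w.
rewrite -(component_eq (coset_compP F) (comp_base F)).
by split=> //; exists p.
Qed.

(** The voltage of the chosen path sends the face of [base_flag O] to the root face, so the
    translation changes the reference flag to [base_flag O], whichever path was chosen. *)
Lemma translate_face F O : sub_vertex (coset_comp F) O ->
  left_translate (path_voltage xi (W O (coset_rank F))) (coset_set F) =
  [set h | h (face_at (coset_rank F) (base_flag O)) = face_of F].
Proof.
move=> FO; have := chosen_pathP W O (coset_rank F).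
rewrite (component_eq (coset_compP F) FO) => w.
have {w} := walk_face (sub_component_walk (coset_compP F) w).
rewrite coset_setE /root_face => ->.
set a := path_voltage _ _; apply/seteqP; split=> [_ [h hF <-]//|h hF].
by exists (a^-1 * h)%g; rewrite /= ?mulgA ?mulgV ?mul1g // -hF -[in RHS](mul1g h) -(mulgV a).
Qed.

(** The face determines the index by its rank, the component by its orbit, and the coset by
    [coset_setE]. *)
Lemma face_of_inj : injective face_of.
Proof.
move=> F F' E.
have Er : coset_rank F = coset_rank F'.
  by apply: ord_inj; have := rank_face_of F; rewrite E rank_face_of => -[].
have FF' : sub_vertex (coset_comp F) (f (coset_comp F')).
  apply/comp_vertexP; rewrite Er E; apply/comp_vertexP; exact: comp_base.
have Ec : coset_comp F = coset_comp F'.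
  rewrite -(component_eq (coset_compP F) FF') Er.
  by rewrite (component_eq (coset_compP F') (comp_base F')).
have Es : coset_set F = coset_set F' by rewrite !coset_setE /root_face E Er Ec.
case: F F' Er Ec Es {E FF'} => [i C S a b] [i' C' S' a' b'] /= Ei EC ES.
subst i' C' S'; congr CosetFace; exact: Prop_irrelevance.
Qed.

Lemma face_of_surj i (x : P) : rank x = i -> exists F, face_of F = x.
Proof.
move=> rx; have [Psi Px] := face_flag x.
have [O [g E]] := flag_of_base Psi; pose C := component (@delete_colour n (stg P) i) O.
have CP : is_component (@delete_colour n (stg P) i) C by exists O.
have [_ [p /walk_face w]] := component_base f CP.
have -> : x = g (face_at i (base_flag O)).
  by rewrite -face_at_act -E; apply/esym/face_at_eq.
(* The voltage of [p] sends the face at the base vertex to the one at [O], which [g] sends to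
   [x]. *)
exists (CosetFace CP (ex_intro _ (path_voltage xi p * g)%g erefl)).
set F := CosetFace _ _; have : coset_set F (path_voltage xi p * g)%g.
  by rewrite /= right_coset_stabilizer.
rewrite coset_setE /= => <-.
by rewrite w.
Qed.

(** A common element [h] of the translates at [O] makes [flag_act (base_flag O) h] contain both
    faces, which are then ordered by rank. Conversely, the coordinates of a flag through both faces
    give the vertex and the common element. *)
Lemma coset_face_ltP F F' : coset_face_lt W F F' <-> face_of F < face_of F'.
Proof.
split=> [[rFF' [O [FO F'O]]]|lt].
  rewrite !translate_face // => -[h [/= hF hF']].
  rewrite -hF -hF' -!face_at_act lt_neqAle; apply/andP; split.
    apply/eqP => /(congr1 (@rank n P)); rewrite !rank_face_at.
    by move=> -[E]; rewrite E ltnn in rFF'.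
  apply: flag_le (face_at_flag _ _) (face_at_flag _ _) _.
  by rewrite !rank_face_at.
split; first by have := rank_lt lt; rewrite !rank_face_of.
have [Psi PF PF'] := le_face_flag (ltW lt).
have [O [g E]] := flag_of_base Psi.
have hF : g (face_at (coset_rank F) (base_flag O)) = face_of F.
  by rewrite -face_at_act -E; apply: face_at_eq (rank_face_of _).
have hF' : g (face_at (coset_rank F') (base_flag O)) = face_of F'.
  by rewrite -face_at_act -E; apply: face_at_eq (rank_face_of _).
have FO : sub_vertex (coset_comp F) O by apply/comp_vertexP; exists g.
have F'O : sub_vertex (coset_comp F') O by apply/comp_vertexP; exists g.
by exists O; split=> //; rewrite !translate_face //; exists g.
Qed.

(** * Adjoining the least and greatest elements *)

Definition elt_of (a : coset_elt xi f) : P :=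
  match a with
  | CosetLeast => \bot
  | CosetProper F => face_of F
  | CosetGreatest => \top
  end.

Lemma bot_face_of F : \bot < face_of F.
Proof.
rewrite lt0x; apply/eqP => /(congr1 (@rank n P)).
by rewrite rank_face_of rank_botE.
Qed.

Lemma face_of_top F : face_of F < \top.
Proof.
rewrite ltx1; apply/eqP => /(congr1 (@rank n P)).
rewrite rank_face_of rank_topE => -[E].
by have := ltn_ord (coset_rank F); rewrite E ltnn.
Qed.

Lemma bot_lt_top : (\bot : P) < \top.
Proof.
rewrite lt0x; apply/eqP => /(congr1 (@rank n P)).
by rewrite rank_botE rank_topE.
Qed.

Lemma coset_ltP a b : coset_lt W a b <-> elt_of a < elt_of b.
Proof.
case: a b => [|F|] [|F'|] /=.
- by rewrite ltxx.
- by rewrite bot_face_of.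
- by rewrite bot_lt_top.
- by rewrite ltx0.
- exact: coset_face_ltP.
- by rewrite face_of_top.
- by rewrite ltx0.
- by rewrite lt1x.
- by rewrite ltxx.
Qed.

Lemma elt_of_inj : injective elt_of.
Proof.
move=> [|F|] [|F'|] //= E.
- by have := bot_face_of F'; rewrite E ltxx.
- by have := bot_lt_top; rewrite E ltxx.
- by have := bot_face_of F; rewrite E ltxx.
- by rewrite (face_of_inj E).
- by have := face_of_top F; rewrite E ltxx.
- by have := bot_lt_top; rewrite E ltxx.
- by have := face_of_top F'; rewrite E ltxx.
Qed.

Lemma elt_of_surj (x : P) : exists a, elt_of a = x.
Proof.
(* [Negz 0] is the rank -1; any further negative value violates the bound. *)
have := rank_bound x; case rx : (rank x) => [k|[|k]] xn; last by lia.
  have [kn|nk] := ltnP k n.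
    by have [F <-] := @face_of_surj (Ordinal kn) x rx; exists (CosetProper F).
  by exists (CosetGreatest _ _); rewrite /= (@rank_top _ _ x) // rx; lia.
by exists (CosetLeast _ _); rewrite /= (@rank_bot _ _ x) // rx.
Qed.

End Faces.

End OrbitVoltage.

Theorem mainTheorem1 (n : nat) (n_ge1 : (1 <= n)%N) (P : polytope n) :
  exists xi : voltage (stg P) (order_aut P),
  forall (f : base_choice (stg P)) (W : path_choice f),
  exists phi : P -> coset_elt xi f,
    bijective phi /\ forall x y : P, (x <= y)%O <-> coset_le W (phi x) (phi y).
Proof.
exists (orbit_voltage P) => f W.
(* [phi] is a section of [elt_of], hence its inverse by injectivity. *)
have [phi phiK] := choice (@elt_of_surj _ P f).
exists phi; split=> [|x y].
  by exists (@elt_of _ _ f) => // a; apply: elt_of_inj; rewrite phiK.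
rewrite le_eqVlt; split=> [/orP[/eqP ->|lt]|[E|lt]].
- by left.
- by right; apply/coset_ltP; rewrite !phiK.
- by rewrite -(phiK x) E phiK eqxx.
- by move/coset_ltP: lt; rewrite !phiK => ->; rewrite orbT.
Qed.
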